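(* Let $F_n$ be the free group of rank $n$ and $\varphi\in\mathrm{End}(F_n)$. Then (at least) one of the following holds: 1. $\mathrm{EvFix}(\varphi)=F_n$; 2. $\mathrm{EvFix}(\varphi)=\bigcup_{k=1}^\infty \mathrm{Ker}(\varphi^k)$; 3. $\mathrm{EvFix}(\varphi)$ is not a normal subgroup of $F_n$.
   Context: Maps are written on the right. $\mathrm{EvFix}(\varphi)$ is the subgroup of eventually fixed points of $\varphi$: all $x\in F_n$ such that $x\varphi^m=x\varphi^{m+1}$ for some natural number $m$. The alternatives are not claimed to be mutually exclusive. *)

(* Defs.v *)
From HB Require Import structures.
From mathcomp Require Import all_boot.
From mathcomp Require Import boolp classical_sets.

Set Implicit Arguments.
Unset Strict Implicit.
Unset Printing Implicit Defensive.

Local Open Scope group_scope.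
Local Open Scope classical_set_scope.

Section FreeGroup.
Variable A : choiceType.

(* The letter (a, false) stands for a and (a, true) for its inverse. *)
Local Notation letter := (A * bool)%type.

Implicit Types (l m : letter) (u v w : seq letter).

Definition letter_inv l : letter := (l.1, ~~ l.2).

Definition reduced w : bool := sorted (fun l m => m != letter_inv l) w.

Definition push l w : seq letter :=
  if w is m :: w' then if m == letter_inv l then w' else l :: w else [:: l].

Definition reduce w : seq letter := foldr push [::] w.

Lemma letter_invK : involutive letter_inv.
Proof. by case=> a b; rewrite /letter_inv /= negbK. Qed.

Lemma reduced_behead l w : reduced (l :: w) -> reduced w.
Proof. exact: path_sorted. Qed.

Lemma push_reduced l w : reduced w -> reduced (push l w).
Proof.
case: w => [//|m w] /= rw; case: eqP => [_|/eqP ne] /=.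
  exact: path_sorted rw.
by rewrite /reduced /= ne.
Qed.

Lemma foldr_push_reduced u w : reduced w -> reduced (foldr push w u).
Proof. by move=> rw; elim: u => //= l u; apply: push_reduced. Qed.

Lemma reduce_reduced w : reduced (reduce w).
Proof. exact: foldr_push_reduced. Qed.

Lemma pushK l w : reduced w -> push l (push (letter_inv l) w) = w.
Proof.
case: w => [_|m w] /=; first by rewrite eqxx.
rewrite letter_invK; case: eqP => [->|_ _] /=; last by rewrite eqxx.
by case: w => [//|p w] /andP[/negPf /= ->].
Qed.

Lemma reduce_id w : reduced w -> reduce w = w.
Proof.
elim: w => //= l w IH rw; rewrite IH ?(reduced_behead rw) //.
by case: w rw {IH} => //= m w /andP[/negPf->].
Qed.

Lemma foldr_push_push l u w :
  reduced w -> foldr push w (push l u) = push l (foldr push w u).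
Proof.
move=> rw; case: u => [//|m u] /=; case: eqP => [->|//].
by rewrite pushK // foldr_push_reduced.
Qed.

Lemma foldr_push_reduce u w :
  reduced w -> foldr push w (reduce u) = foldr push w u.
Proof. by move=> rw; elim: u => //= l u IH; rewrite foldr_push_push ?IH. Qed.

Lemma reduce_cat u v : reduce (u ++ v) = foldr push (reduce v) u.
Proof. by rewrite /reduce foldr_cat. Qed.

Lemma reduce_catl u v : reduce (reduce u ++ v) = reduce (u ++ v).
Proof. by rewrite !reduce_cat foldr_push_reduce ?reduce_reduced. Qed.

Lemma reduce_catr u v : reduce (u ++ reduce v) = reduce (u ++ v).
Proof. by rewrite !reduce_cat (reduce_id (reduce_reduced v)). Qed.

Definition word_inv w : seq letter := rev (map letter_inv w).

Lemma word_inv_reduced w : reduced w -> reduced (word_inv w).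
Proof.
rewrite /word_inv /reduced rev_sorted sorted_map; apply: sub_sorted => l m.
by rewrite /= letter_invK; apply: contra_neq => ->.
Qed.

Lemma reduce_word_invl w : reduced w -> reduce (word_inv w ++ w) = [::].
Proof.
elim: w => //= l w IH rw.
rewrite /word_inv /= rev_cons cat_rcons.
have rl := reduced_behead rw.
rewrite reduce_cat /= -[X in push X (push _ _)]/(letter_inv l).
by rewrite -{2}[l]letter_invK pushK ?reduce_reduced // -reduce_cat IH.
Qed.

Lemma word_invK : involutive word_inv.
Proof. by move=> w; rewrite /word_inv map_rev revK mapK //; apply: letter_invK. Qed.

Lemma reduce_word_invr w : reduced w -> reduce (w ++ word_inv w) = [::].
Proof.
by move=> rw; rewrite -{1}[w]word_invK reduce_word_invl ?word_inv_reduced.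
Qed.

Record free_group : Type :=
  FreeGroup { fg_word :> seq letter; fg_wordP : reduced fg_word }.

HB.instance Definition _ := [isSub for fg_word].
HB.instance Definition _ := [Choice of free_group by <:].

Implicit Types x y z : free_group.

Definition fg_one : free_group := @FreeGroup [::] isT.
Definition fg_mul x y : free_group := FreeGroup (reduce_reduced (x ++ y)).
Definition fg_inv x : free_group := FreeGroup (word_inv_reduced (fg_wordP x)).

Lemma fg_mulA : associative fg_mul.
Proof.
by move=> x y z; apply: val_inj; rewrite /= reduce_catl reduce_catr catA.
Qed.
Lemma fg_mul1 : left_id fg_one fg_mul.
Proof. by move=> x; apply/val_inj/reduce_id/fg_wordP. Qed.
Lemma fg_mulr1 : right_id fg_one fg_mul.
Proof. by move=> x; apply: val_inj; rewrite /= cats0 reduce_id ?fg_wordP. Qed.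
Lemma fg_mulV : left_inverse fg_one fg_inv fg_mul.
Proof. by move=> x; apply/val_inj/reduce_word_invl/fg_wordP. Qed.
Lemma fg_mulrV : right_inverse fg_one fg_inv fg_mul.
Proof. by move=> x; apply/val_inj/reduce_word_invr/fg_wordP. Qed.

HB.instance Definition _ := isGroup.Build free_group
  fg_mulA fg_mul1 fg_mulr1 fg_mulV fg_mulrV.

Definition fg_gen (a : A) : free_group := @FreeGroup [:: (a, false)] isT.

Section UniversalProperty.
Variables (G : groupType) (f : A -> G).

Definition letter_eval l : G := if l.2 then (f l.1)^-1 else f l.1.

Definition fg_lift x : G := \prod_(l <- fg_word x) letter_eval l.

Lemma prod_reduce w :
  \prod_(l <- reduce w) letter_eval l = \prod_(l <- w) letter_eval l.
Proof.
elim: w => //= l w; rewrite big_cons => <-.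
case: (reduce w) => [|m u] /=; first by rewrite big_seq1 big_nil mulg1.
case: eqP => [->|_]; last by rewrite !big_cons.
rewrite big_cons mulgA /letter_eval /=; case: l => a [] /=.
  by rewrite mulVg mul1g.
by rewrite mulgV mul1g.
Qed.

Lemma fg_liftM : {morph fg_lift : x y / x * y}.
Proof. by move=> x y; rewrite /fg_lift prod_reduce big_cat. Qed.

Lemma fg_lift1 : fg_lift 1 = 1.
Proof. by rewrite /fg_lift big_nil. Qed.

HB.instance Definition _ :=
  isUMagmaMorphism.Build free_group G fg_lift (fg_lift1, fg_liftM).

Lemma free_group_universal :
  exists2 phi : UMagmaMorphism.type free_group G,
    (forall a, phi (fg_gen a) = f a) &
    forall psi : UMagmaMorphism.type free_group G,
      (forall a, psi (fg_gen a) = f a) -> psi =1 phi.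
Proof.
exists fg_lift => [a|psi psiE]; first by rewrite /= /fg_lift big_seq1.
case=> w rw; rewrite /= /fg_lift /=.
have psi1 : psi 1 = 1 by rewrite gmulf1.
elim: w rw => [|l w IH] rw.
  by rewrite big_nil -psi1; congr (psi _); apply: val_inj.
have rl := reduced_behead rw.
rewrite big_cons -(IH rl).
have rs : reduced [:: l] by [].
have -> : FreeGroup rw = FreeGroup rs * FreeGroup rl.
  by apply: val_inj; rewrite /= -(reduce_id rw) /= (reduce_id rl).
rewrite gmulfM; congr (_ * _); case: l rs {rw rl} => a [] rs.
  have -> : FreeGroup rs = (fg_gen a)^-1 by apply: val_inj.
  by rewrite gmulfV psiE.
by rewrite /letter_eval /= -psiE; congr (psi _); apply: val_inj.
Qed.

End UniversalProperty.
End FreeGroup.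

Section Subgroups.
Variable G : groupType.

Definition is_subgroup (H : set G) : Prop := group_closed (mem H).

Definition is_normal_subgroup (H : set G) : Prop :=
  is_subgroup H /\ forall x y : G, H x -> H (x ^ y).

Definition Ker (f : G -> G) : set G := [set x | f x = 1].

Definition EvFix (phi : G -> G) : set G :=
  [set x | exists m : nat, iter m phi x = iter m.+1 phi x].

Lemma EvFix_subgroup (phi : UMagmaMorphism.type G G) :
  is_subgroup (EvFix phi).
Proof.
have itM k x y : iter k phi (x / y) = iter k phi x / iter k phi y.
  by elim: k => //= k ->; rewrite gmulfM gmulfV.
have stab x m : iter m phi x = iter m.+1 phi x ->
    forall k, (m <= k)%N -> iter k phi x = iter k.+1 phi x.
  move=> e k /subnK <-; elim: (k - m)%N => // j IH.
  by rewrite addSn iterS {1}IH.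
split=> [|x y /set_mem[m xm] /set_mem[p yp]]; apply/mem_set.
  by exists 0%N; rewrite /= gmulf1.
exists (maxn m p); rewrite !itM.
by rewrite -(stab _ _ xm) ?leq_maxl // -(stab _ _ yp) ?leq_maxr.
Qed.

End Subgroups.

(* Main.v *)
Require Import Defs.
From HB Require Import structures.
From mathcomp Require Import all_boot.
From mathcomp Require Import zify boolp classical_sets.

Local Open Scope classical_set_scope.

(** If no nontrivial element is fixed by phi, the fixed value that an
    eventually fixed element reaches is 1, so EvFix phi is the union of the
    kernels of the iterates.  The content is that, when some u != 1 is fixed
    and EvFix phi is normal, every y is eventually fixed.

    By normality the conjugates of u by y and by y^-1 are eventually fixed.
    Put z = phi^k(y) with k large: then u^z and u^(z^-1) are fixed by phi,
    which says that c = phi(z) z^-1 and phi(z^-1) z = (c^z)^-1 both commute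
    with u ([commute_of_fixed_conj]).  The rest uses how elements commute in
    a free group ([fixed_of_twist]).  If c != 1, then c and c^z commute with
    each other because commutation is transitive on nontrivial elements
    ([commute_trans]); then some positive power of c is conjugated by z to a power
    of c, comparing lengths shows that it goes to itself or its inverse, so
    z^2, and hence z, commutes with c ([commute_conjg_self]).
    Hence z commutes with u.  But phi fixes everything that commutes with u,
    since such an element has a positive power equal to a power of u and
    roots are unique ([fixed_centralizer]).  So phi(z) = z in all cases, and
    y is eventually fixed.

    The facts on commutation come from words.  After a conjugation one of the
    two commuting elements, c, is cyclically reduced; then one of the products
    of the other element y with c and c^-1 has no cancellation, so the equation
    in the group becomes y ++ c = c ++ y between words, up to replacing c by
    c^-1 ([commute_cyc]).  For words, commutation is elementary: a word
    commuting with a power of u commutes with u ([comm_wpow_root]), and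
    commuting words u, v satisfy u^|v| = v^|u| ([comm_wpow_size]). *)

(** * Commuting words *)

Section Words.
Set Implicit Arguments.
Unset Strict Implicit.
Local Open Scope nat_scope.
Variable T : Type.
Implicit Types u v w : seq T.

Definition wpow n u : seq T := flatten (nseq n u).

Lemma size_wpow n u : size (wpow n u) = n * size u.
Proof. by elim: n => //= n IH; rewrite /wpow /= size_cat IH. Qed.

Lemma wpowD m n u : wpow (m + n) u = wpow m u ++ wpow n u.
Proof. by rewrite /wpow nseqD flatten_cat. Qed.

Lemma wpowM m n u : wpow n (wpow m u) = wpow (n * m) u.
Proof. by elim: n => //= n IH; rewrite mulSn wpowD -IH. Qed.

Lemma wpow_comm n u v : u ++ v = v ++ u -> wpow n u ++ v = v ++ wpow n u.
Proof.
move=> uv; elim: n => [|n IH]; first by rewrite cats0.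
by rewrite /wpow /= -catA IH catA uv -catA.
Qed.

Lemma cat_injl u v w w' : size u = size v -> u ++ w = v ++ w' -> u = v.
Proof.
by move=> e /(congr1 (take (size u))); rewrite take_size_cat // take_size_cat.
Qed.

(** Both sides have length |u| |v| and commute, and commuting words of equal
    length are equal. *)
Lemma comm_wpow_size u v :
  u ++ v = v ++ u -> wpow (size v) u = wpow (size u) v.
Proof.
move=> uv; apply: (@cat_injl _ _ (wpow (size u) v) (wpow (size v) u)).
  by rewrite !size_wpow mulnC.
by apply/wpow_comm/esym/wpow_comm.
Qed.

(** The word v commutes with arbitrarily long powers of u; in such a power,
    u ++ v and v ++ u are both prefixes, of the same length. *)
Lemma comm_wpow_root n u v :
  0 < n -> wpow n u ++ v = v ++ wpow n u -> u ++ v = v ++ u.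
Proof.
move=> n_gt0 comm.
case: u comm => [|a u0]; first by rewrite cats0.
set u := a :: u0 => comm.
(* An exponent divisible by n and large enough for sz. *)
set N := (size v).+1 * n.
have commN : wpow N u ++ v = v ++ wpow N u by rewrite -wpowM; apply: wpow_comm.
have uN : u ++ wpow N u = wpow N u ++ u by exact/esym/wpow_comm.
have sz : size (u ++ v) <= size (wpow N u).
  by rewrite size_wpow size_cat /N /u /=; nia.
have takeE w w' : size w = size (u ++ v) -> w ++ wpow N u = wpow N u ++ w' ->
    w = take (size (u ++ v)) (wpow N u).
  move=> e /(congr1 (take (size (u ++ v)))).
  by rewrite take_size_cat // takel_cat.
rewrite (takeE (u ++ v) (u ++ v)) // -?catA.
  by rewrite -(takeE (v ++ u) (v ++ u)) ?size_cat 1?addnC // -catA uN !catA commN.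
by rewrite -commN !catA uN.
Qed.

End Words.

(** * Reduced and cyclically reduced words *)

Section FreeGroupTheory.
Set Implicit Arguments.
Unset Strict Implicit.
Local Open Scope group_scope.
Variable A : choiceType.
Local Notation letter := (A * bool)%type.
Local Notation F := (free_group A).
Implicit Types (l m : letter) (u v w : seq letter) (x y z c : F).

Lemma fg_word_inj : injective (@fg_word A).
Proof. exact: val_inj. Qed.

Lemma fg_wordM x y : fg_word (x * y) = reduce (x ++ y). Proof. by []. Qed.

Lemma fg_wordV x : fg_word x^-1 = word_inv x. Proof. by []. Qed.

Lemma size_push l w : (size (push l w) <= (size w).+1)%N.
Proof. by case: w => //= m w; case: ifP => //= _; lia. Qed.

Lemma size_reduce w : (size (reduce w) <= size w)%N.
Proof. by elim: w => //= l w IH; apply: leq_trans (size_push _ _) _. Qed.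

(** A word that loses no letter in the reduction had no cancelling pair: this
    is how lengths decide whether a product is a mere concatenation. *)
Lemma reduce_size_id w : size (reduce w) = size w -> reduce w = w.
Proof.
elim: w => //= l w IH e.
have szw : size (reduce w) = size w.
  by have := size_push l (reduce w); have := size_reduce w; lia.
rewrite IH //; move: e; rewrite IH //; case: w {IH szw} => //= m w.
by case: ifP => //= _; lia.
Qed.

Lemma size_mulg x y : (size (x * y)%g <= size x + size y)%N.
Proof. by rewrite fg_wordM -size_cat size_reduce. Qed.

Lemma size_invg x : size x^-1 = size x.
Proof. by rewrite fg_wordV /word_inv size_rev size_map. Qed.

Lemma size_fg_gt0 x : (0 < size x)%N = (x != 1).
Proof. by rewrite lt0n size_eq0 -(inj_eq fg_word_inj). Qed.

Lemma reduced_cat_cons u l m v :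
  reduced (rcons u l ++ m :: v) =
  [&& reduced (rcons u l), m != letter_inv l & reduced (m :: v)].
Proof. by rewrite cat_rcons /reduced sorted_cat_cons. Qed.

(** Having no cancellation in the square is the usual condition that the last
    and first letters are not inverse to each other; stated this way it covers
    the empty word as well. *)
Definition cyc_reduced x := reduced (x ++ x).

Lemma reduced_wpow n x : cyc_reduced x -> reduced (wpow n x).
Proof.
rewrite /cyc_reduced; case: (fg_word x) => [|l w] /= cx; first by elim: n.
case: n => // n; rewrite /reduced /wpow /=.
move: cx; rewrite /reduced /= cat_path /= => /and3P[pw lw _].
by elim: n => [|n IH] /=; rewrite ?cats0 // cat_path pw /= lw.
Qed.

Lemma fg_wordX n x : fg_word (x ^+ n) = reduce (wpow n x).
Proof. by elim: n => // n IH; rewrite expgS fg_wordM IH reduce_catr. Qed.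

Lemma fg_word_cycX n x : cyc_reduced x -> fg_word (x ^+ n) = wpow n x.
Proof. by move=> cx; rewrite fg_wordX reduce_id ?reduced_wpow. Qed.

Lemma cyc_reducedX n x : cyc_reduced x -> cyc_reduced (x ^+ n).
Proof. by move=> cx; rewrite /cyc_reduced fg_word_cycX // -wpowD reduced_wpow. Qed.

Lemma cyc_reducedV x : cyc_reduced x -> cyc_reduced x^-1.
Proof.
rewrite /cyc_reduced => cx.
have -> : x^-1 ++ x^-1 = word_inv (x ++ x) by rewrite /word_inv map_cat rev_cat.
exact: word_inv_reduced.
Qed.

Lemma letter_neq_inv l : l != letter_inv l.
Proof. by case: l => a []; rewrite /letter_inv /= xpair_eqE andbF. Qed.

(** Otherwise the word has the form l w l^-1, and conjugating by l leaves the
    shorter word w: induction on the length. *)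
Lemma exists_cyc_reduced_conj x : exists z, cyc_reduced (x ^ z).
Proof.
have [n] := ubnP (size x); elim: n x => // n IH x.
case: (boolP (cyc_reduced x)) => [cx _|]; first by exists 1; rewrite conjg1.
case xE: (fg_word x) => [|l w]; first by rewrite /cyc_reduced xE.
have := fg_wordP x; rewrite {1}/cyc_reduced xE.
case/lastP: w xE => [_ _|w m xE rx]; first by rewrite /reduced /= letter_neq_inv.
rewrite -rcons_cons reduced_cat_cons rcons_cons rx andbT /= => /negPn/eqP lE.
have rw : reduced w.
  by move: rx; rewrite -rcons_cons -cats1 => /cat_sorted2[/reduced_behead].
have rl : reduced [:: l] by [].
pose y := FreeGroup rw; pose a := FreeGroup rl.
have -> : x = y ^ a^-1.
  apply: fg_word_inj; rewrite /conjg invgK mulgA !fg_wordM reduce_catl.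
  rewrite fg_wordV -[word_inv a]/[:: letter_inv l] lE letter_invK cats1.
  by rewrite -[rcons _ _]/(l :: rcons w m) reduce_id.
rewrite size_rcons /= => lt.
have [z cz] : exists z, cyc_reduced (y ^ z) by apply: IH => /=; lia.
by exists (a * z); rewrite conjgM conjgKV.
Qed.

(** The last letter of y could cancel against both products only if it were
    inverse to the first letter of c and equal to its last letter, which cyclic
    reduction excludes. *)
Lemma reduced_cat_or y c :
  cyc_reduced c -> reduced (y ++ c) \/ reduced (y ++ c^-1).
Proof.
move=> cc; have := fg_wordP c^-1.
move: cc; have := fg_wordP c; have := fg_wordP y.
rewrite /cyc_reduced fg_wordV; case/lastP: (fg_word y) => [|u l]; first by left.
case: (fg_word c) => [|m w]; first by left; rewrite cats0.
move=> ru rc cc; rewrite reduced_cat_cons ru rc andbT /=.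
case: (eqVneq m (letter_inv l)) => [mE rV|]; last by left.
move: cc; rewrite {1}lastI reduced_cat_cons => /and3P[_ mk _]; right.
move: rV; rewrite lastI /word_inv map_rcons rev_rcons => rV.
by rewrite reduced_cat_cons ru rV andbT /= -mE eq_sym.
Qed.

(** * Commutation in free groups *)

(** If y ++ d is reduced, it is the word of y * d = d * y, so the reduction of
    d ++ y keeps its length and is trivial. *)
Lemma commute_cyc c y : cyc_reduced c -> commute y c ->
  y ++ c = c ++ y \/ y ++ c^-1 = c^-1 ++ y.
Proof.
move=> cc.
have core d : commute y d -> reduced (y ++ d) -> y ++ d = d ++ y.
  move=> /(congr1 (@fg_word A)); rewrite !fg_wordM => yd rd.
  rewrite (reduce_id rd) in yd.
  by rewrite yd; apply: reduce_size_id; rewrite -yd !size_cat addnC.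
move=> yc; case: (reduced_cat_or y cc) => r; [left|right]; apply: core => //.
exact: commuteV.
Qed.

Lemma commute_conj x y z : commute (x ^ z) (y ^ z) <-> commute x y.
Proof. by rewrite /commute -!conjMg; split=> [/conjg_inj|->]. Qed.

(** The group form of [comm_wpow_root]; it yields the uniqueness of roots
    and the transitivity of commutation. *)
Lemma commute_root n x y : (0 < n)%N -> commute y (x ^+ n) -> commute y x.
Proof.
move=> n_gt0 yx.
have [z cx] := exists_cyc_reduced_conj x.
apply/(commute_conj _ _ z).
move/(commute_conj _ _ z): yx; rewrite conjXg.
move: (x ^ z) (y ^ z) cx => {}x {}y cx yx.
have core c : cyc_reduced c -> y ++ c ^+ n = c ^+ n ++ y -> commute y c.
  move=> cc; rewrite fg_word_cycX // => /esym/(comm_wpow_root n_gt0) e.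
  by apply: fg_word_inj; rewrite !fg_wordM e.
case: (commute_cyc (cyc_reducedX n cx) yx) => [/core|]; first exact.
by rewrite -expVgn => /(core _ (cyc_reducedV cx))/commuteV; rewrite invgK.
Qed.

Lemma expg_eq1 n x : (0 < n)%N -> x ^+ n = 1 -> x = 1.
Proof.
move=> n_gt0 xn1; have [z cx] := exists_cyc_reduced_conj x.
apply: (conjg_inj z); rewrite conj1g; apply/fg_word_inj/size0nil.
have : size ((x ^ z) ^+ n) = 0%N by rewrite -conjXg xn1 conj1g.
rewrite fg_word_cycX // size_wpow => /eqP.
by rewrite muln_eq0 eqn0Ngt n_gt0 => /eqP.
Qed.

Lemma commute_expg_inj n x y :
  (0 < n)%N -> commute x y -> x ^+ n = y ^+ n -> x = y.
Proof.
move=> n_gt0 xy e; apply/divg1_eq/(expg_eq1 n_gt0).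
by rewrite expgnFl // e mulgV.
Qed.

(** The part of the theorem on cyclic centralizers that is used below; the
    exponents are the lengths given by [comm_wpow_size], and two cases replace
    an integer exponent. *)
Lemma commute_expg x y : x != 1 -> commute y x ->
  exists p q, (0 < p)%N /\ (y ^+ p = x ^+ q \/ y ^+ p = x^-1 ^+ q).
Proof.
move=> x_n1 yx.
have [z cx] := exists_cyc_reduced_conj x.
move/(commute_conj _ _ z): yx => yx.
have p_gt0 : (0 < size (x ^ z)%g)%N by rewrite size_fg_gt0 conjg_eq1.
have core c : y ^ z ++ c = c ++ y ^ z ->
    (y ^ z) ^+ size c = c ^+ size (y ^ z).
  by move/comm_wpow_size => e; apply: fg_word_inj; rewrite !fg_wordX e.
exists (size (x ^ z)%g), (size (y ^ z)%g); split => //.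
case: (commute_cyc cx yx) => /core e; [left|right]; apply: (conjg_inj z).
  by rewrite !conjXg e.
by rewrite !conjXg conjVg -e size_invg.
Qed.

(** Some positive power of y is a power of x or of x^-1, hence commutes with z;
    [commute_root] descends to y. *)
Lemma commute_trans x y z : x != 1 -> commute y x -> commute z x -> commute y z.
Proof.
move=> x_n1 yx zx; have [p [q [p_gt0 e]]] := commute_expg x_n1 yx.
apply/commute_sym/(commute_root p_gt0).
case: e => ->; apply: commuteX => //; exact: commuteV.
Qed.

(** Raised to the n-th power, the equation compares lengths that grow like
    p n |c| and q n |c|, where c is a cyclically reduced conjugate of x, while
    conjugation changes a length by at most a constant. *)
Lemma conj_expg_leq x z p q : x != 1 ->
  (x ^+ p) ^ z = x ^+ q \/ (x ^+ p) ^ z = x^-1 ^+ q -> (q <= p)%N.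
Proof.
move=> x_n1 e; have [g cx] := exists_cyc_reduced_conj x.
(* n exceeds the length 2 |t| that a conjugation by t can add. *)
set c := x ^ g in cx; set t := z ^ g; set n := (2 * size t).+1.
have c_gt0 : (0 < size c)%N by rewrite size_fg_gt0 conjg_eq1.
have szE : size ((c ^+ (p * n)) ^ t)%g = (q * n * size c)%N.
  rewrite -size_wpow -fg_word_cycX // !expgnA conjXg -[c ^+ p]conjXg -conjJg.
  by case: e => ->; rewrite conjXg // conjVg !expVgn size_invg.
have : (size ((c ^+ (p * n)) ^ t)%g <= size t + (p * n * size c + size t))%N.
  rewrite -size_wpow -fg_word_cycX // -{1}(size_invg t).
  by apply: leq_trans (size_mulg _ _) _; rewrite leq_add2l size_mulg.
rewrite {}szE => le; rewrite leqNgt; apply/negP => pq.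
have : (p.+1 * n * size c <= q * n * size c)%N by rewrite !leq_mul2r pq !orbT.
rewrite !mulSn mulnDl; have : (n <= n * size c)%N by rewrite leq_pmulr.
by rewrite {1}/n; lia.
Qed.

(** Some x^p with p > 0 is conjugated by z to x^(+-q), and [conj_expg_leq] used
    in both directions gives p = q.  With the sign +, z commutes with x^p, hence
    with x; with the sign -, z^2 does, and [commute_root] brings z^2 back to z. *)
Lemma commute_conjg_self x z : commute (x ^ z) x -> commute z x.
Proof.
have [->|x_n1] := eqVneq x 1; first by move=> _; apply: commute1.
move=> /(commute_expg x_n1)[p [q [p_gt0]]]; rewrite -conjXg => e.
have qp : (q <= p)%N by apply: conj_expg_leq e.
have pq : (p <= q)%N.
  apply: (@conj_expg_leq x z^-1) => //.
  case: e => e; [left|right]; apply: (conjg_inj z); rewrite conjgKV //.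
  by rewrite expVgn conjVg e expVgn invgK.
have {pq qp} pE : q = p by lia.
rewrite {q}pE in e.
case: e => e.
  apply: (commute_root p_gt0); apply/commute_sym.
  by rewrite /commute conjgC e.
apply: commute_sym; apply: (@commute_root 2) => //; apply: commute_sym.
apply: (commute_root p_gt0); apply: commute_sym.
by rewrite /commute conjgC expgS conjgM e expVgn conjVg e expVgn invgK.
Qed.

End FreeGroupTheory.

(** * Eventually fixed elements *)

Section IteratedEndomorphism.
Set Implicit Arguments.
Unset Strict Implicit.
Local Open Scope group_scope.
Variables (G : groupType) (phi : UMagmaMorphism.type G G).
Implicit Types x y : G.

Lemma iterM k : {morph iter k phi : x y / x * y}.
Proof. by elim: k => // k IH x y; rewrite !iterS IH gmulfM. Qed.

Lemma iterV k : {morph iter k phi : x / x^-1}.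
Proof. by elim: k => // k IH x; rewrite !iterS IH gmulfV. Qed.

Lemma iter_stab x m k :
  (m <= k)%N -> iter m phi x = iter m.+1 phi x ->
  phi (iter k phi x) = iter k phi x.
Proof.
move=> /subnK <- e; elim: (k - m)%N => [|j IH]; first by rewrite add0n -iterS.
by rewrite addSn !iterS {1}IH.
Qed.

End IteratedEndomorphism.

Section EventuallyFixed.
Set Implicit Arguments.
Unset Strict Implicit.
Local Open Scope group_scope.
Variables (A : choiceType).
Local Notation F := (free_group A).
Variable phi : UMagmaMorphism.type F F.
Implicit Types u x y z c : F.

(** A power c^p with p > 0 is a power of u or of u^-1, hence fixed, so c and
    phi c are p-th roots of the same element; they commute, as both commute
    with u. *)
Lemma fixed_centralizer u c : u != 1 -> phi u = u -> commute c u -> phi c = c.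
Proof.
move=> u_n1 fu cu; have [p [q [p_gt0 e]]] := commute_expg u_n1 cu.
have fcu : commute (phi c) u by rewrite -fu; apply: gmulf_commute.
apply: (commute_expg_inj p_gt0); first exact: commute_trans fcu cu.
by rewrite -gmulfXn; case: e => ->; rewrite gmulfXn ?gmulfV fu.
Qed.

(** Besides c = phi z * z^-1, the conjugate c ^ z commutes with u, being inverse
    to phi z^-1 * z.  Unless c = 1, this makes z commute with c and so with u. *)
Lemma fixed_of_twist u z : u != 1 -> phi u = u ->
  commute (phi z * z^-1) u -> commute (phi z^-1 * z) u -> phi z = z.
Proof.
move=> u_n1 fu; set c := phi z * z^-1 => cu.
have -> : phi z^-1 * z = (c ^ z)^-1.
  by rewrite /c /conjg mulgVK invgM invgK gmulfV.
move=> /commute_sym/commuteV/commute_sym; rewrite invgK => czu.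
have [/divg1_eq //|c_n1] := eqVneq c 1.
apply: (fixed_centralizer u_n1 fu); apply: (commute_trans c_n1).
  by apply: commute_conjg_self; apply: commute_trans u_n1 czu cu.
exact: commute_sym.
Qed.

Lemma commute_of_fixed_conj u z :
  phi u = u -> phi (u ^ z) = u ^ z -> commute (phi z * z^-1) u.
Proof.
rewrite gmulfJ => -> e.
by apply: commute_sym; rewrite /commute conjgC conjgM e conjgK.
Qed.

(** A common exponent k makes the k-th iterates of u ^ y and u ^ y^-1 fixed;
    the conjugate by y^-1 provides the second hypothesis of
    [fixed_of_twist]. *)
Lemma EvFix_normal_full u : is_normal_subgroup (EvFix phi) ->
  u != 1 -> phi u = u -> EvFix phi = [set: F].
Proof.
move=> [_ nN] u_n1 fu; apply/seteqP; split=> // y _.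
have fuk k : iter k phi u = u by elim: k => //= k ->.
have uE : EvFix phi u by exists 0%N.
have [m1 e1] := nN _ y uE; have [m2 e2] := nN _ y^-1 uE.
pose k := maxn m1 m2.
have iterJ x : iter k phi (u ^ x) = u ^ iter k phi x.
  by rewrite /conjg !iterM iterV fuk.
have f1 := iter_stab (leq_maxl m1 m2) e1.
have f2 := iter_stab (leq_maxr m1 m2) e2.
rewrite -/k !iterJ in f1 f2; rewrite iterV in f2.
exists k; rewrite iterS; move: (iter k phi y) f1 f2 => z f1 f2.
apply/esym/(fixed_of_twist u_n1 fu); first exact: commute_of_fixed_conj.
by rewrite -{2}[z]invgK; apply: commute_of_fixed_conj.
Qed.

End EventuallyFixed.

Theorem proposition3p2 (n : nat)
    (phi : UMagmaMorphism.type (free_group 'I_n) (free_group 'I_n)) :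
  EvFix phi = [set: free_group 'I_n] \/
  EvFix phi = \bigcup_(k in [set k : nat | (0 < k)%N]) Ker (iter k phi) \/
  ~ is_normal_subgroup (EvFix phi).
Proof.
have [normal|] := pselect (is_normal_subgroup (EvFix phi)); last by right; right.
have [[u [u_n1 fu]]|no_fix] := pselect (exists u, u != 1%g /\ phi u = u).
  by left; apply: EvFix_normal_full u_n1 fu.
right; left; apply/seteqP; split=> [x [m e]|x [k _ e]].
  exists m.+1 => //; rewrite /Ker /= -iterS -e.
  by apply: contrapT => /eqP u_n1; apply: no_fix; exists (iter m phi x).
by exists k; rewrite iterS e gmulf1.
Qed.
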